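(* There exist universal constants $0<c\le C<\infty$ such that for all positive integers $m,n$ and every matrix $A\in\mathbb{R}^{m\times n}$: (i) $c\,V(A) \le \mathrm{disc}_{\mathrm v}(A) \le C\,V(A)$, where $V(A) := \min\{\max_{i\in[m]}\mathbb{E}|(Ag)_i| : g\sim\mathcal N(0,\Sigma),\ \Sigma\in\mathbb{S}^n_+,\ \Sigma_{jj}=1 \ \forall j\in[n]\}$; (ii) $c\,S(A) \le \mathrm{disc}_{\mathrm s}(A) \le C\,S(A)$, where $S(A) := \min\{\mathbb{E}\max_{i\in[m]}|(Ag)_i| : g\sim\mathcal N(0,\Sigma),\ \Sigma\in\mathbb{S}^n_+,\ \mathrm{tr}\,\Sigma = n\}$.
   Context: $\mathbb{S}^n_+$ denotes the set of symmetric positive semidefinite $n\times n$ matrices, $S^{n-1}$ the unit sphere in $\mathbb{R}^n$. Vector discrepancy: $\mathrm{disc}_{\mathrm v}(A) := \min\{\max_{i\in[m]}\|\sum_{j=1}^n A_{i,j}u_j\|_2 : u_1,\dots,u_n\in S^{n-1}\}$. Spherical discrepancy: $\mathrm{disc}_{\mathrm s}(A) := \min\{\|Ax\|_\infty : x\in\mathbb{R}^n,\ \|x\|_2=\sqrt n\}$. *)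

(* Defs.v *)
From mathcomp Require Export all_boot all_order all_algebra.
From mathcomp Require Export all_classical all_reals all_analysis.

Set Implicit Arguments.
Unset Strict Implicit.
Unset Printing Implicit Defensive.

Import Order.TTheory GRing.Theory Num.Theory.
Import numFieldNormedType.Exports.

Local Open Scope classical_set_scope.
Local Open Scope ring_scope.

(* MathComp-Analysis norms matrices by the sup norm, so the Euclidean norm of a
   column vector has to be introduced separately. *)
Definition norm2 (R : realType) (n : nat) (x : 'cV[R]_n) : R :=
  Num.sqrt (\sum_(j < n) x j 0 ^+ 2).

(* All maxima below are over nonnegative quantities, hence the default 0. *)
Definition vdisc_values (R : realType) (m n : nat) (A : 'M[R]_(m, n)) : set R :=
  [set x | exists u : 'I_n -> 'cV[R]_n, (forall j, norm2 (u j) = 1) /\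
     x = \big[Num.max/0]_(i < m) norm2 (\sum_(j < n) A i j *: u j)].

(* The norm `|A *m x| is the sup norm. *)
Definition sdisc_values (R : realType) (m n : nat) (A : 'M[R]_(m, n)) : set R :=
  [set y | exists x : 'cV[R]_n,
     norm2 x = Num.sqrt (n%:R) /\ y = `|A *m x|].

Definition disc_v (R : realType) (m n : nat) (A : 'M[R]_(m, n)) : R :=
  inf (vdisc_values A).

Definition disc_s (R : realType) (m n : nat) (A : 'M[R]_(m, n)) : R :=
  inf (sdisc_values A).

Definition psd (R : realType) (n : nat) (Sigma : 'M[R]_n) : Prop :=
  Sigma^T = Sigma /\ forall v : 'cV[R]_n, 0 <= (v^T *m Sigma *m v) 0 0.

(* Random vectors take values in n.-tuple R, whose sigma-algebra is the product
   of the Borel sigma-algebras. *)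
Definition vec (R : realType) (n : nat) (x : n.-tuple R) : 'cV[R]_n :=
  \col_j tnth x j.

Definition unvec (R : realType) (n : nat) (x : 'cV[R]_n) : n.-tuple R :=
  [tuple x j 0 | j < n].

(* gamma is the n-fold product of N(0, 1). *)
Definition std_gaussian (R : realType) (n : nat)
    (gamma : probability (n.-tuple R) R) : Prop :=
  forall S : 'I_n -> set R, (forall i, measurable (S i)) ->
    gamma [set z | forall i, S i (tnth z i)] =
    (\prod_(i < n) normal_prob 0 1 (S i))%E.

(* g ~ N(0, Sigma), with Sigma possibly singular: g has the law of B z, where
   B B^T = Sigma and z has independent N(0, 1) coordinates. *)
Definition gaussian_vector (R : realType) (n : nat) (Sigma : 'M[R]_n)
    (d : measure_display) (T : measurableType d) (P : probability T R)
    (g : {RV P >-> n.-tuple R}) : Prop :=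
  exists (B : 'M[R]_n) (gamma : probability (n.-tuple R) R),
    [/\ B *m B^T = Sigma, std_gaussian gamma &
        forall S : set (n.-tuple R), measurable S ->
          distribution P g S = gamma [set z | S (unvec (B *m vec z))]].

Definition V_values (R : realType) (m n : nat) (A : 'M[R]_(m, n)) :
    set (\bar R) :=
  [set x | exists (Sigma : 'M[R]_n) (d : measure_display)
      (T : measurableType d) (P : probability T R) (g : {RV P >-> n.-tuple R}),
    [/\ psd Sigma, forall j, Sigma j j = 1, gaussian_vector Sigma g &
        x = (\big[maxe/0]_(i < m) 'E_P[fun w => `|(A *m vec (g w)) i 0|%R])%E]].

Definition S_values (R : realType) (m n : nat) (A : 'M[R]_(m, n)) :
    set (\bar R) :=
  [set x | exists (Sigma : 'M[R]_n) (d : measure_display)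
      (T : measurableType d) (P : probability T R) (g : {RV P >-> n.-tuple R}),
    [/\ psd Sigma, \tr Sigma = n%:R, gaussian_vector Sigma g &
        x = ('E_P[fun w => (\big[Num.max/0]_(i < m) `|(A *m vec (g w)) i 0|)%R])%E]].

Definition gaussian_V (R : realType) (m n : nat) (A : 'M[R]_(m, n)) : \bar R :=
  ereal_inf (V_values A).

Definition gaussian_S (R : realType) (m n : nat) (A : 'M[R]_(m, n)) : \bar R :=
  ereal_inf (S_values A).

(* Main.v *)
(** Let [z] be standard Gaussian. Then [E |<a, z>|] is comparable to [|a|], with
    absolute constants: the coordinates are independent, symmetric and have
    finite moments, so [E <a, z>^2] is proportional to [|a|^2] while
    [E <a, z>^4] is at most a constant times [|a|^4]. Every competitor for
    [V(A)] or [S(A)] is [g = B z], and its value depends on the matrix [B] only.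

    (i) The rows of [B] are unit vectors, i.e. a competitor for the vector
    discrepancy, and [E |(A B z)_i|] is comparable to the norm of row [i] of
    [A B].

    (ii) Taking [B = x e_1^T] gives [E |A g|_oo = |A x|_oo E |z_1|], hence
    [S(A) <= C disc_s(A)]. Conversely let [s_j] be the norm of row [j] of [B], so
    that [sum_j s_j^2 = n]. By homogeneity [disc_s(A) |y| <= sqrt n |A y|_oo] for
    every [y], and by Cauchy-Schwarz [sum_j s_j |y_j| <= sqrt n |y|]; combining
    both at [y = B z] and taking expectations,
    [n E |A B z|_oo >= disc_s(A) sum_j s_j E |(B z)_j| >= c n disc_s(A)].

    The minima are attained because [B] ranges over a compact set and all the
    values depend continuously on [B]. *)
Require Import Defs.
From HB Require Import structures.
From mathcomp Require Import all_boot all_order all_algebra.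
From mathcomp Require Import all_classical all_reals all_analysis.
From mathcomp Require Import measurable_realfun ring lra.
Import Order.TTheory GRing.Theory Num.Theory.
Import numFieldNormedType.Exports.

Set Implicit Arguments.
Unset Strict Implicit.
Unset Printing Implicit Defensive.

Local Open Scope classical_set_scope.
Local Open Scope ring_scope.

(** * The standard normal law *)

(** The law is dominated by Lebesgue measure, so the integral can be rewritten with its
    Radon-Nikodym derivative. That derivative agrees almost everywhere with [normal_pdf], because
    both have the same integral over every measurable set. *)
Lemma ge0_integral_normal_prob (R : realType) (m s : R)
    (f : _ -> \bar R) :
  measurable_fun [set: measurableTypeR R] f -> (forall x, (0 <= f x)%E) ->
  (\int[normal_prob m s]_x f x =
   \int[lebesgue_measure]_x (f x * (normal_pdf m s x)%:E))%E.
Proof.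
move=> mf f0.
have dom := normal_prob_dominates m s.
have mpdf : measurable_fun [set: measurableTypeR R] (EFin \o normal_pdf m s).
  by apply/measurable_EFinP; exact: measurable_normal_pdf.
pose g := Radon_Nikodym_SigmaFinite.f (normal_prob m s) (@lebesgue_measure R).
have gi : (@lebesgue_measure R).-integrable setT g.
  exact: Radon_Nikodym_SigmaFinite.f_integrable.
rewrite -(Radon_Nikodym_SigmaFinite.change_of_variables dom)//.
apply: ae_eq_integral => //.
- by apply: emeasurable_funM => //; exact: measurable_int gi.
- exact: emeasurable_funM.
- apply: ae_eqe_mul2l; apply: integral_ae_eq => // E _ mE.
  by rewrite -Radon_Nikodym_SigmaFinite.f_integral.
Qed.

(* [normal_prob] lives on [measurableTypeR R], whose display differs from the
   one of [R] itself. *)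
Definition of_measurableTypeR (R : realType) : measurableTypeR R -> R := idfun.

Lemma measurable_of_measurableTypeR (R : realType) :
  measurable_fun [set: measurableTypeR R] (@of_measurableTypeR R).
Proof. by move=> _ A mA; rewrite setTI. Qed.

HB.instance Definition _ (R : realType) :=
  isMeasurableFun.Build _ _ _ _ (@of_measurableTypeR R)
    (@measurable_of_measurableTypeR R).

Definition std_normal (R : realType) : probability R R :=
  distribution (normal_prob (0 : R) 1) (@of_measurableTypeR R).

Lemma ge0_integral_std_normal (R : realType) (f : R -> \bar R) :
  measurable_fun [set: R] f -> (forall x, (0 <= f x)%E) ->
  (\int[std_normal R]_x f x =
   \int[lebesgue_measure]_x (f x * (normal_pdf 0 1 x)%:E))%E.
Proof.
move=> mf f0; rewrite ge0_integral_distribution//.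
exact: ge0_integral_normal_prob.
Qed.

(** The density is even and Lebesgue measure is invariant under reflection. This symmetry later
    eliminates the odd powers from moment computations. *)
Lemma ge0_integral_std_normalN (R : realType) (f : R -> \bar R) :
  measurable_fun [set: R] f -> (forall x, (0 <= f x)%E) ->
  (\int[std_normal R]_x f (- x)%R = \int[std_normal R]_x f x)%E.
Proof.
move=> mf f0.
have pdfN x : normal_pdf 0 1 (- x) = normal_pdf 0 1 x :> R.
  by rewrite !normal_pdfE// /normal_fun !subr0 sqrrN.
have mpdf : measurable_fun [set: R] (EFin \o normal_pdf 0 1).
  by apply/measurable_EFinP; exact: measurable_normal_pdf.
have mN : measurable_fun [set: measurableTypeR R]
  (-%R : measurableTypeR R -> measurableTypeR R) by exact: oppr_measurable.
rewrite !ge0_integral_std_normal//; last exact: (measurableT_comp mf mN).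
transitivity (\int[pushforward lebesgue_measure
    (-%R : measurableTypeR R -> measurableTypeR R)]_x
    (f x * (normal_pdf 0 1 x)%:E))%E; last first.
  by apply: eq_measure_integral => A mA _; exact: lebesgue_measureN.
have mf' : measurable_fun [set: measurableTypeR R]
  (fun x => f x * (normal_pdf 0 1 x)%:E)%E by exact: emeasurable_funM.
have /= := ge0_integral_pushforward mN lebesgue_measure measurableT mf'.
move=> ->.
  by rewrite preimage_setT; apply: eq_integral => x _ /=; rewrite pdfN.
by move=> x _; rewrite mule_ge0// lee_fin normal_pdf_ge0.
Qed.

(** The integrand is dominated by a multiple of the density of standard deviation 2, whose total
    mass is 1; no moment has to be evaluated. *)
Lemma std_normal_fourth_moment_lty (R : realType) :
  (\int[std_normal R]_x (x ^+ 4)%:E < +oo)%E.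
Proof.
have mX4 : measurable_fun [set: R] (fun x : R => (x ^+ 4)%:E).
  by apply/measurable_EFinP; exact: measurable_funX.
have X40 (x : R) : (0 <= (x ^+ 4)%:E)%E by rewrite lee_fin exprn_even_ge0.
have s1 : (1 : R) != 0 := oner_neq0 _.
have s2 : (2 : R) != 0 by rewrite pnatr_eq0.
have mpdf s : measurable_fun [set: R] (EFin \o normal_pdf 0 s).
  by apply/measurable_EFinP; exact: measurable_normal_pdf.
(* With [u = 3/16 x^2], one has [x^4 = 256/9 u^2] and [exp(-x^2/2) = exp(-u)^2 exp(-x^2/8)]. Since
   [u exp(-u) <= 1], the constant 256/9 suffices; 29 rounds it up, and the peaks convert between the
   two normalizations. *)
pose C : R := 29 * normal_peak 1 / normal_peak 2.
have p1 := @normal_peak_gt0 R 1 s1; have p2 := @normal_peak_gt0 R 2 s2.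
have C0 : 0 <= C by rewrite divr_ge0 ?mulr_ge0 ?(ltW p1) ?(ltW p2).
rewrite ge0_integral_std_normal//.
apply: (@le_lt_trans _ _ (\int[lebesgue_measure]_x (C%:E * (normal_pdf 0 2 x)%:E))%E).
  apply: ge0_le_integral => //=.
  - by move=> x _; rewrite mule_ge0// lee_fin normal_pdf_ge0.
  - by apply: emeasurable_funM => //; exact: mpdf.
  - by apply: emeasurable_funM => //; exact: mpdf.
  - move=> x _; rewrite -!EFinM lee_fin !normal_pdfE// /normal_fun subr0.
    set u := 3 / 16 * x ^+ 2.
    have u0 : 0 <= u by rewrite mulr_ge0// sqr_ge0.
    have eu : 1 + u <= expR u := expR_ge1Dx u.
    have -> : - x ^+ 2 / (1 ^+ 2 *+ 2) = - u - u + (- x ^+ 2 / (2 ^+ 2 *+ 2)) :> R.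
      by rewrite /u; field.
    set v := - x ^+ 2 / (2 ^+ 2 *+ 2).
    have -> : x ^+ 4 = (16 / 3 * u) ^+ 2 by rewrite /u; field.
    have uw1 : u * expR (- u) <= 1.
      rewrite expRN ler_pdivrMr ?expR_gt0// mul1r; lra.
    have uw0 : 0 <= u * expR (- u) by rewrite mulr_ge0 ?expR_ge0.
    rewrite !expRD; set w := expR (- u) in uw1 uw0 *.
    have -> : (16 / 3 * u) ^+ 2 * (normal_peak 1 * (w * w * expR v)) =
        256 / 9 * (u * w) ^+ 2 * (normal_peak 1 * expR v) by field.
    have -> : C * (normal_peak 2 * expR v) = 29 * (normal_peak 1 * expR v).
      by rewrite /C; field; rewrite gt_eqF.
    apply: ler_wpM2r; first by rewrite mulr_ge0 ?expR_ge0 ?(ltW p1).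
    nra.
rewrite ge0_integralZl//=.
- by rewrite integral_normal_pdf mule1 ltry.
- exact: mpdf.
- by move=> x _; rewrite lee_fin normal_pdf_ge0.
Qed.

Lemma std_normal_second_moment_lty (R : realType) :
  (\int[std_normal R]_x (x ^+ 2)%:E < +oo)%E.
Proof.
apply: (@le_lt_trans _ _ (\int[std_normal R]_x ((x ^+ 4)%:E + 1))%E).
  apply: ge0_le_integral => //=.
  - by move=> x _; rewrite lee_fin sqr_ge0.
  - by apply/measurable_EFinP; exact: measurable_funX.
  - by apply: emeasurable_funD => //; apply/measurable_EFinP; exact: measurable_funX.
  - by move=> x _; rewrite -EFinD lee_fin; nra.
rewrite ge0_integralD//=.
- rewrite lte_add_pinfty ?std_normal_fourth_moment_lty//.
  by rewrite integral_cst//= mul1e; exact: fin_num_fun_lty.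
- by move=> x _; rewrite lee_fin exprn_even_ge0.
- by apply/measurable_EFinP; exact: measurable_funX.
Qed.

(** If the integral vanished, [x^2] would be zero almost everywhere, so the complement of the origin
    would be null. The origin is null too, by domination, which contradicts total mass 1. *)
Lemma std_normal_second_moment_gt0 (R : realType) :
  (0 < \int[std_normal R]_x (x ^+ 2)%:E)%E.
Proof.
have mX2 : measurable_fun [set: R] (fun x : R => (x ^+ 2)%:E).
  by apply/measurable_EFinP; exact: measurable_funX.
rewrite lt_neqAle integral_ge0 ?andbT; last by move=> x _; rewrite lee_fin sqr_ge0.
apply/eqP => /esym; under eq_integral do rewrite -[(_ ^+ 2)%:E]gee0_abs ?lee_fin ?sqr_ge0//.
move/(ae_eq_integral_abs _ measurableT mX2).
pose Z : set R := [set 0].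
have mZ : measurable Z by exact: measurable_set1.
have Z0 : std_normal R Z = 0%E.
  have /null_content_dominatesP := normal_prob_dominates (0 : R) 1.
  by apply=> //; exact: lebesgue_measure_set1.
move=> [A [mA A0 subA]].
have AZT : A `|` Z = setT.
  rewrite -subTset => x _; have [->|x0] := eqVneq x 0; [by right|left].
  apply: subA => /= /(_ I) /eqP; rewrite eqe sqrf_eq0; exact/negP.
have : (std_normal R (A `|` Z) <= std_normal R A + std_normal R Z)%E.
  exact: measureU2.
by rewrite AZT probability_setT A0 Z0 adde0 lee_fin ler10.
Qed.

(** * Moments of Gaussian linear forms *)

(** The coefficients are a function, so that a row [M i] of a matrix can be passed directly. *)
Definition dotr (R : realType) (n : nat) (a : 'I_n -> R) (z : n.-tuple R) : R :=
  \sum_(i < n) a i * tnth z i.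

Lemma measurable_dotr (R : realType) (n : nat) (a : 'I_n -> R) :
  measurable_fun [set: n.-tuple R] (dotr a).
Proof.
apply: measurable_sum => i; apply: measurable_funM => //.
exact: measurable_tnth.
Qed.

Lemma measurable_box (R : realType) (n : nat) (S : 'I_n -> set R) :
  (forall i, measurable (S i)) ->
  measurable [set z : n.-tuple R | forall i, S i (tnth z i)].
Proof.
move=> mS.
rewrite (_ : mkset _ = \bigcap_(i in [set: 'I_n])
    ((fun z : n.-tuple R => tnth z i) @^-1` S i)); last first.
  by apply/seteqP; split=> z /= zS i; [move=> _; exact: zS|exact: (zS i I)].
apply: fin_bigcap_measurable => // i _.
by rewrite -[X in measurable X]setTI; exact: measurable_tnth.
Qed.

(** The moments stay unevaluated constants: the argument relies on finiteness, on positivity for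
    [k = 2] and on nonnegativity for [k = 4]. *)
Definition std_normal_moment (R : realType) (k : nat) : R :=
  fine (\int[std_normal R]_x (x ^+ k)%:E).

Section normal_moments.
Variable R : realType.
Local Notation N := (std_normal R).
Local Notation v2 := (std_normal_moment R 2).
Local Notation v4 := (std_normal_moment R 4).

Let v2E : (\int[N]_x (x ^+ 2)%:E = v2%:E)%E.
Proof.
rewrite fineK// ge0_fin_numE ?std_normal_second_moment_lty//.
by apply: integral_ge0 => x _; rewrite lee_fin sqr_ge0.
Qed.

Let v4E : (\int[N]_x (x ^+ 4)%:E = v4%:E)%E.
Proof.
rewrite fineK// ge0_fin_numE ?std_normal_fourth_moment_lty//.
by apply: integral_ge0 => x _; rewrite lee_fin exprn_even_ge0.
Qed.

Lemma std_normal_moment2_gt0 : 0 < v2.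
Proof. by rewrite -lte_fin -v2E std_normal_second_moment_gt0. Qed.

Lemma std_normal_moment4_ge0 : 0 <= v4.
Proof.
by rewrite -lee_fin -v4E integral_ge0// => x _; rewrite lee_fin exprn_even_ge0.
Qed.

Let integral_cstN (r : R) : (\int[N]_x r%:E = r%:E)%E.
Proof. by rewrite integral_cst//= (@probability_setT _ _ _ N) mule1. Qed.

(** Here [g] is the even part of [f]. By symmetry of the law the odd part contributes nothing, and
    working with nonnegative functions avoids any integrability condition on odd powers. *)
Let integral_even_part (f g : R -> R) : measurable_fun [set: R] f ->
  (forall x, 0 <= f x) -> (forall x, f x + f (- x) = 2 * g x) ->
  (\int[N]_x (f x)%:E = \int[N]_x (g x)%:E)%E.
Proof.
move=> mf f0 fg.
have mEf : measurable_fun [set: R] (EFin \o f) by exact/measurable_EFinP.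
have mEfN : measurable_fun [set: R] (EFin \o f \o -%R).
  exact: measurableT_comp.
have mg : measurable_fun [set: R] (EFin \o g).
  apply/measurable_EFinP.
  rewrite (_ : g = (fun x => 2^-1 * (f x + (f \o -%R) x))).
    apply: measurable_funM => //; apply: measurable_funD => //.
    exact: measurableT_comp.
  by apply/funext => x /=; rewrite fg mulrA mulVf ?mul1r.
have g0 x : 0 <= g x by have := f0 x; have := f0 (- x); have := fg x; lra.
have : (\int[N]_x (f x)%:E + \int[N]_x (f x)%:E = 2%:E * \int[N]_x (g x)%:E)%E.
  rewrite -[X in (_ + X)%E](ge0_integral_std_normalN mEf).
    rewrite -ge0_integralD//=; last 2 first.
      by move=> x _; rewrite lee_fin.
      by move=> x _; rewrite lee_fin.
    rewrite -ge0_integralZl//=.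
      by apply: eq_integral => x _; rewrite -EFinD -EFinM fg.
    by move=> x _; rewrite lee_fin.
  by move=> x /=; rewrite lee_fin.
have : (0 <= \int[N]_x (f x)%:E)%E by apply: integral_ge0 => x _; rewrite lee_fin.
have : (0 <= \int[N]_x (g x)%:E)%E by apply: integral_ge0 => x _; rewrite lee_fin.
case: (\int[N]_x (f x)%:E)%E => [a| |]; case: (\int[N]_x (g x)%:E)%E => [b| |] //=.
- by move=> _ _; rewrite -EFinD -EFinM => -[ab]; congr EFin; lra.
- by move=> _ _; rewrite gt0_muley ?lte_fin.
Qed.

Lemma std_normal_affine_second_moment (a y : R) :
  (\int[N]_x ((a * x + y) ^+ 2)%:E = (a ^+ 2 * v2 + y ^+ 2)%:E)%E.
Proof.
rewrite (@integral_even_part _ (fun x => a ^+ 2 * x ^+ 2 + y ^+ 2)).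
- under eq_integral do rewrite EFinD EFinM.
  rewrite ge0_integralD//=.
  + rewrite ge0_integralZl//= ?v2E ?integral_cstN// ?lee_fin ?sqr_ge0//.
      by apply/measurable_EFinP; exact: measurable_funX.
    by move=> x _; rewrite lee_fin sqr_ge0.
  + by move=> x _; rewrite -EFinM lee_fin mulr_ge0 ?sqr_ge0.
  + apply: emeasurable_funM => //.
    by apply/measurable_EFinP; exact: measurable_funX.
  + by move=> x _; rewrite lee_fin sqr_ge0.
- by apply: measurable_funX; apply: measurable_funD => //; exact: measurable_funM.
- by move=> x; exact: sqr_ge0.
- by move=> x; ring.
Qed.

Lemma std_normal_affine_fourth_moment (a y : R) :
  (\int[N]_x ((a * x + y) ^+ 4)%:E =
   (a ^+ 4 * v4 + 6 * a ^+ 2 * v2 * y ^+ 2 + y ^+ 4)%:E)%E.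
Proof.
have ge04 (r : R) : 0 <= r ^+ 4 by rewrite exprn_even_ge0.
have mX k : measurable_fun [set: R] (fun x : R => (x ^+ k)%:E).
  by apply/measurable_EFinP; exact: measurable_funX.
rewrite (@integral_even_part _
  (fun x => a ^+ 4 * x ^+ 4 + (6 * a ^+ 2 * y ^+ 2 * x ^+ 2 + y ^+ 4))).
- under eq_integral do rewrite EFinD EFinM EFinD [in X in (_ + (X + _))%E]EFinM.
  have c0 : 0 <= 6 * a ^+ 2 * y ^+ 2 by rewrite mulr_ge0 ?sqr_ge0// mulr_ge0 ?sqr_ge0.
  have p1 (x : R) : (0 <= (6 * a ^+ 2 * y ^+ 2)%:E * (x ^+ 2)%:E)%E.
    by rewrite -EFinM lee_fin mulr_ge0 ?sqr_ge0.
  have m1 : measurable_fun [set: R]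
      (fun x : R => (6 * a ^+ 2 * y ^+ 2)%:E * (x ^+ 2)%:E)%E.
    by apply: emeasurable_funM => //; exact: mX.
  rewrite ge0_integralD//=.
  + rewrite ge0_integralD//=; last by move=> x _; rewrite lee_fin.
    rewrite !ge0_integralZl//= ?lee_fin//.
    * by rewrite v2E v4E integral_cstN -!EFinM -!EFinD; congr EFin; ring.
    * by move=> x _; rewrite lee_fin sqr_ge0.
    * by move=> x _; rewrite lee_fin.
  + by move=> x _; rewrite -EFinM lee_fin mulr_ge0.
  + by apply: emeasurable_funM => //; exact: mX.
  + by move=> x _; rewrite adde_ge0// lee_fin.
  + exact: emeasurable_funD.
- by apply: measurable_funX; apply: measurable_funD => //; exact: measurable_funM.
- by move=> x; exact: ge04.
- by move=> x; ring.
Qed.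

End normal_moments.

(** * Construction and uniqueness of the standard Gaussian measure *)

Lemma ge0_integral_probability_affine d (T : measurableType d) (R : realType)
    (P : probability T R) (k c : R) (f g : T -> R) :
  0 <= k -> 0 <= c -> measurable_fun [set: T] f -> measurable_fun [set: T] g ->
  (forall x, 0 <= f x) -> (forall x, 0 <= g x) ->
  (\int[P]_x (k + c * f x + g x)%:E =
   k%:E + c%:E * \int[P]_x (f x)%:E + \int[P]_x (g x)%:E)%E.
Proof.
move=> k0 c0 mf mg f0 g0.
have mh : measurable_fun [set: T] (fun x => c * f x) by exact: measurable_funM.
have mkh : measurable_fun [set: T] (fun x => k + c * f x).
  exact: measurable_funD.
have h0 x : 0 <= c * f x by exact: mulr_ge0.
under eq_integral do rewrite EFinD.
rewrite (@ge0_integralD _ _ _ P setT measurableT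
  (fun x => (k + c * f x)%:E) (fun x => (g x)%:E)); first 1 last.
- by move=> x _; rewrite lee_fin addr_ge0.
- exact/measurable_EFinP.
- by move=> x _; rewrite lee_fin.
- exact/measurable_EFinP.
congr (_ + _)%E; under eq_integral do rewrite EFinD.
rewrite (@ge0_integralD _ _ _ P setT measurableT
  (fun x => k%:E) (fun x => (c * f x)%:E)); first 1 last.
- by move=> x _; rewrite lee_fin.
- exact: measurable_cst.
- by move=> x _; rewrite lee_fin.
- exact/measurable_EFinP.
congr (_ + _)%E; first by rewrite integral_cst//= probability_setT mule1.
under eq_integral do rewrite EFinM.
rewrite (@ge0_integralZl _ _ _ P setT measurableT (fun x => (f x)%:E))//.
- exact/measurable_EFinP.
- by move=> x _; rewrite lee_fin.
Qed.

Lemma dotrS (R : realType) (n : nat) (a : 'I_n.+1 -> R) (x : R)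
    (z : n.-tuple R) :
  dotr a [tuple of x :: z] = a ord0 * x + dotr (fun i => a (lift ord0 i)) z.
Proof.
rewrite /dotr big_ord_recl tnth0; congr (_ + _).
by apply: eq_bigr => i _; rewrite tnthS.
Qed.

(** The Gaussian measure in dimension [n.+1] is the image under this map of the product of
    [std_normal] with the one in dimension [n]. *)
Definition tuple_cons (R : realType) (n : nat) (p : R * n.-tuple R) :
  n.+1.-tuple R := [tuple of p.1 :: p.2].

Lemma measurable_tuple_cons (R : realType) (n : nat) :
  measurable_fun [set: R * n.-tuple R] (@tuple_cons R n).
Proof. exact: measurable_cons. Qed.

HB.instance Definition _ (R : realType) (n : nat) :=
  isMeasurableFun.Build _ _ _ _ (@tuple_cons R n) (@measurable_tuple_cons R n).

Lemma ge0_integral_tuple_cons (R : realType) (n : nat)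
    (gamma : probability (n.-tuple R) R) (f : n.+1.-tuple R -> \bar R) :
  measurable_fun [set: n.+1.-tuple R] f -> (forall z, (0 <= f z)%E) ->
  (\int[distribution (std_normal R \x gamma) (@tuple_cons R n)]_z f z =
   \int[gamma]_z \int[std_normal R]_x f [tuple of x :: z])%E.
Proof.
move=> mf f0; rewrite ge0_integral_distribution// fubini_tonelli2//=.
by apply: measurableT_comp => //; exact: measurable_tuple_cons.
Qed.

(** The moment estimates are carried through the induction that builds the measure. By Tonelli the
    first coordinate is integrated first, with the other coordinates fixed, so each step reduces to
    the moments of an affine function of one normal variable. *)
Lemma std_gaussian_with_moments (R : realType) (n : nat) (K : R) :
  std_normal_moment R 4 <= K -> 3 * std_normal_moment R 2 ^+ 2 <= K ->
  exists gamma : probability (n.-tuple R) R,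
  [/\ std_gaussian gamma,
   forall a, (\int[gamma]_z (dotr a z ^+ 2)%:E =
     (std_normal_moment R 2 * \sum_(i < n) a i ^+ 2)%:E)%E &
   forall a, (\int[gamma]_z (dotr a z ^+ 4)%:E <=
     (K * (\sum_(i < n) a i ^+ 2) ^+ 2)%:E)%E].
Proof.
move=> v4K v2K; set v2 := std_normal_moment R 2 in v2K *.
have mdX k n' a : measurable_fun [set: n'.-tuple R] (fun z => (dotr a z ^+ k)%:E).
  by apply/measurable_EFinP/measurable_funX; exact: measurable_dotr.
have d2 n' a (z : n'.-tuple R) : 0 <= dotr a z ^+ 2 by exact: sqr_ge0.
have d4 n' a (z : n'.-tuple R) : 0 <= dotr a z ^+ 4 by rewrite exprn_even_ge0.
have v20 : 0 < v2 := std_normal_moment2_gt0 R.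
elim: n => [|n [gamma [gG gm2 gm4]]].
  exists (dirac [tuple]); split => [S mS|a|a].
  - rewrite big_ord0 (_ : mkset _ = setT) ?probability_setT//.
    by apply/seteqP; split=> // z _ [].
  - rewrite big_ord0 mulr0 integral0_eq// => z _.
    by rewrite /dotr big_ord0 expr0n.
  - rewrite big_ord0 expr0n/= mulr0 integral0_eq// => z _.
    by rewrite /dotr big_ord0 expr0n.
exists (distribution (std_normal R \x gamma)%E (@tuple_cons R n)).
split => [S mS|a|a].
- rewrite big_ord_recl -gG//.
  set B := [set z : n.-tuple R | _].
  have mB : measurable B.
    by apply: (@measurable_box _ _ (fun i : 'I_n => S (lift ord0 i))) => i.
  transitivity ((std_normal R \x gamma)%E (S ord0 `*` B)); last first.
    by apply: product_measure1E => //; exact: mS.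
  suff <- : @tuple_cons R n @^-1` [set z | forall i, S i (tnth z i)] =
      S ord0 `*` B by [].
  apply/seteqP; split => [[x z]/= zS|[x z]/= [xS zS] i].
    split; first by have := zS ord0; rewrite /tuple_cons tnth0.
    by move=> i; have := zS (lift ord0 i); rewrite /tuple_cons tnthS.
  case: (unliftP ord0 i) => [j ->|->]; rewrite /tuple_cons ?tnthS ?tnth0//.
- rewrite ge0_integral_tuple_cons//; last by move=> z; rewrite lee_fin.
  set b := fun i => a (lift ord0 i).
  under eq_integral do under eq_integral do rewrite dotrS -/b.
  have mD k : measurable_fun [set: n.-tuple R] (fun z => dotr b z ^+ k).
    by apply: measurable_funX; exact: measurable_dotr.
  under eq_integral do rewrite std_normal_affine_second_moment -/v2.
  (* A null term [0 * 0] is inserted to match the shape [k + c * f x + g x] with [f] constantly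
     zero. *)
  under eq_integral do rewrite -[X in (X + _)%:E]addr0 -(mul0r 0).
  rewrite (@ge0_integral_probability_affine _ _ _ gamma _ _ (cst 0))//.
  - rewrite gm2 mul0e adde0 -EFinD big_ord_recl.
    by congr EFin; rewrite mulrDr (mulrC v2 (a ord0 ^+ 2)).
  - by rewrite mulr_ge0 ?sqr_ge0// ltW.
- rewrite ge0_integral_tuple_cons//; last by move=> z; rewrite lee_fin.
  set b := fun i => a (lift ord0 i).
  under eq_integral do under eq_integral do rewrite dotrS -/b.
  have mD k : measurable_fun [set: n.-tuple R] (fun z => dotr b z ^+ k).
    by apply: measurable_funX; exact: measurable_dotr.
  have a0 : 0 <= a ord0 ^+ 2 by exact: sqr_ge0.
  have c0 : 0 <= 6 * a ord0 ^+ 2 * v2 by rewrite mulr_ge0 ?(ltW v20)// mulr_ge0.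
  have k0 : 0 <= a ord0 ^+ 4 * std_normal_moment R 4.
    by rewrite mulr_ge0 ?std_normal_moment4_ge0// exprn_even_ge0.
  under eq_integral do rewrite std_normal_affine_fourth_moment -/v2.
  rewrite (@ge0_integral_probability_affine _ _ _ gamma)// gm2.
  apply: (le_trans (leeD2l _ (gm4 _))).
  rewrite -!EFinM -!EFinD lee_fin big_ord_recl /=.
  set s := \sum_(i < n) _.
  have s0 : 0 <= s by apply: sumr_ge0 => i _; exact: sqr_ge0.
  (* The target [K (a_0^2 + s)^2] is expanded and compared term by term: the cross term uses
     [3 v2^2 <= K], the pure fourth power uses [v4 <= K], and [K s^2] is the induction
     hypothesis. *)
  have : 6 * a ord0 ^+ 2 * v2 * (v2 * s) <= 2 * K * a ord0 ^+ 2 * s.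
    have : 0 <= (a ord0 ^+ 2 * s) * (K - 3 * v2 ^+ 2).
      by rewrite mulr_ge0 ?subr_ge0// mulr_ge0.
    lra.
  have : a ord0 ^+ 4 * std_normal_moment R 4 <= K * (a ord0 ^+ 2) ^+ 2.
    by rewrite -exprM mulrC ler_wpM2r// exprn_even_ge0.
  lra.
Qed.

(** Boxes are stable under intersection, generate the product sigma-algebra and have prescribed
    measure. Uniqueness transfers the moments of the constructed measure to every measure satisfying
    [std_gaussian]. *)
Lemma std_gaussian_unique (R : realType) (n : nat)
    (gamma1 gamma2 : probability (n.-tuple R) R) :
  std_gaussian gamma1 -> std_gaussian gamma2 ->
  forall X : set (n.-tuple R), measurable X -> gamma1 X = gamma2 X.
Proof.
move=> g1 g2 X mX.
pose box (S : 'I_n -> set R) := [set z : n.-tuple R | forall i, S i (tnth z i)].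
pose G : set (set (n.-tuple R)) :=
  [set B | exists2 S, (forall i, measurable (S i)) & B = box S].
have mG : G `<=` measurable by move=> _ [S mS ->]; exact: measurable_box.
have boxT : box (fun=> setT) = setT by apply/seteqP; split.
have GT : G setT by exists (fun=> setT).
apply: (measure_unique G (fun=> setT)) => //.
- apply/seteqP; split; last exact: smallest_sub (@sigma_algebra_measurable _ _) mG.
  apply: smallest_sub; first exact: smallest_sigma_algebra.
  move=> B /=; rewrite -bigcup_seq => -[i _ [A mA <-{B}]]; apply: sub_sigma_algebra.
  (* A cylinder over coordinate [i] is a box whose other sides are the whole line. *)
  exists (fun j => if j == i then A else setT) => [j|].
    by case: ifP => _ //; exact: measurableT.
  apply/seteqP; split => z /=.
    by move=> -[_ Az] j; case: ifPn => // /eqP ->.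
  by move=> /(_ i); rewrite eqxx.
- move=> _ _ [S mS ->] [U mU ->]; exists (fun i => S i `&` U i) => [i|].
    exact: measurableI.
  apply/seteqP; split=> z /=; first by move=> [Sz Uz] i; split; [exact: Sz|exact: Uz].
  by move=> SUz; split=> i; have [] := SUz i.
- by apply/seteqP; split => // z _; exists 0%N.
- by move=> _ [S mS ->]; apply: (etrans (g1 S mS)); exact/esym/g2.
- by move=> _ /=; rewrite probability_setT ltry.
Qed.

Lemma std_gaussian_eq_integral (R : realType) (n : nat)
    (gamma1 gamma2 : probability (n.-tuple R) R) (f : n.-tuple R -> \bar R) :
  std_gaussian gamma1 -> std_gaussian gamma2 ->
  (\int[gamma1]_z f z = \int[gamma2]_z f z)%E.
Proof.
by move=> g1 g2; apply: eq_measure_integral => A mA _; exact: std_gaussian_unique.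
Qed.

Lemma std_gaussian_exists (R : realType) (n : nat) :
  exists gamma : probability (n.-tuple R) R, std_gaussian gamma.
Proof.
set v2 := std_normal_moment R 2; set v4 := std_normal_moment R 4.
have [||gamma []] := @std_gaussian_with_moments R n (v4 + 3 * v2 ^+ 2).
- by rewrite lerDl mulr_ge0 ?sqr_ge0.
- by rewrite lerDr std_normal_moment4_ge0.
- by exists gamma.
Qed.

(** Both bounds come from integrating pointwise polynomial estimates of [|x|]: a minorant in [x^2]
    and [x^4] from below, a majorant in [x^2] from above. The scale is adapted to the norm of [a],
    so the constants do not depend on the dimension. *)
Lemma dotr_first_moment (R : realType) : exists alpha beta : R,
  [/\ 0 < alpha, 0 < beta & forall n (gamma : probability (n.-tuple R) R),
   std_gaussian gamma -> forall a : 'I_n -> R,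
   ((alpha * Num.sqrt (\sum_(i < n) a i ^+ 2))%:E <=
      \int[gamma]_z `|dotr a z|%:E)%E /\
   (\int[gamma]_z `|dotr a z|%:E <=
      (beta * Num.sqrt (\sum_(i < n) a i ^+ 2))%:E)%E].
Proof.
set v2 := std_normal_moment R 2; set v4 := std_normal_moment R 4.
have v20 : 0 < v2 := std_normal_moment2_gt0 R.
have v40 : 0 <= v4 := std_normal_moment4_ge0 R.
(* The first two summands meet the requirements on the fourth moment constant; the third one ensures
   [v2 <= K], hence [l <= 1]. *)
pose K := v4 + 3 * v2 ^+ 2 + v2.
have K0 : 0 < K by rewrite /K; nra.
pose l := v2 / K.
have l0 : 0 < l by rewrite divr_gt0.
have lK : l * K = v2 by rewrite divfK ?gt_eqF.
have l1 : l <= 1 by rewrite ler_pdivrMr// mul1r /K; nra.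
(* This is what the minorant yields at scale [t = l / s], divided by the norm [s]. As [l K = v2], it
   equals [l v2 (3/4 - l/16)], which is positive. The second constant is the integral of the
   majorant divided by [s]. *)
pose alpha := 3 / 4 * l * v2 - l ^+ 3 * K / 16.
exists alpha, ((1 + v2) / 2); split.
- have -> : alpha = l * v2 * (3 / 4 - l / 16).
    by rewrite /alpha exprSr -(mulrA _ l) lK; field.
  apply: mulr_gt0; first exact: mulr_gt0.
  by move: l1; clear; move: l => l; lra.
- lra.
move=> n gamma0 gG0 a.
have [||gamma [gG gm2 gm4]] := @std_gaussian_with_moments R n K.
- by rewrite /K -/v4; nra.
- by rewrite /K -/v2; nra.
rewrite (std_gaussian_eq_integral _ gG0 gG).
set S := \sum_(i < n) a i ^+ 2.
have S0 : 0 <= S by apply: sumr_ge0 => i _; exact: sqr_ge0.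
set s := Num.sqrt S.
have sS : s ^+ 2 = S by rewrite sqr_sqrtr.
have mX : measurable_fun [set: n.-tuple R] (dotr a) := measurable_dotr a.
have mXk k : measurable_fun [set: n.-tuple R] (fun z => dotr a z ^+ k).
  exact: measurable_funX.
have mN : measurable_fun [set: n.-tuple R] (fun z => `|dotr a z|).
  exact: measurableT_comp.
have X4 z : 0 <= dotr a z ^+ 4 by rewrite exprn_even_ge0.
(* Both estimates divide by [s]; when [s = 0] all coefficients vanish and so does the linear
   form. *)
have [s_eq0|s_neq0] := eqVneq s 0.
  have az i : a i = 0.
    have : S = 0 by rewrite -sS s_eq0 expr0n.
    move=> /eqP; rewrite psumr_eq0 => [/allP/(_ i)|j _]; last exact: sqr_ge0.
    by rewrite mem_index_enum sqrf_eq0 => /(_ isT)/eqP.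
  rewrite s_eq0 !mulr0 integral0_eq// => z _.
  by rewrite /dotr big1 ?normr0// => i _; rewrite az mul0r.
have s0 : 0 < s by rewrite lt_neqAle eq_sym s_neq0 sqrtr_ge0.
split.
  pose t := l / s.
  have t0 : 0 < t by rewrite divr_gt0.
  (* The inequality [|x| >= 3/4 x^2 - x^4/16], applied to [t x]; it amounts to
     [(|x| - 2)^2 (|x| + 4) >= 0]. *)
  have key z : 3 / 4 * t * dotr a z ^+ 2 <=
      0 + t ^+ 3 / 16 * dotr a z ^+ 4 + `|dotr a z|.
    rewrite add0r; set x := dotr a z.
    have -> : x ^+ 2 = `|x| ^+ 2 by rewrite real_normK ?num_real.
    have -> : x ^+ 4 = `|x| ^+ 4 by rewrite -normrX ger0_norm// /x.
    have : 0 <= `|x| := normr_ge0 x.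
    move: (`|x|) => y y0.
    have ty0 : 0 <= t * y by rewrite mulr_ge0// ltW.
    rewrite -subr_ge0.
    have -> : t ^+ 3 / 16 * y ^+ 4 + y - 3 / 4 * t * y ^+ 2 =
        y * ((t * y - 2) ^+ 2 * (t * y + 4)) / 16 by field.
    by rewrite divr_ge0// mulr_ge0// mulr_ge0 ?sqr_ge0 ?addr_ge0.
  have : ((3 / 4 * t)%:E * (v2 * S)%:E <=
      (t ^+ 3 / 16)%:E * (K * S ^+ 2)%:E + \int[gamma]_z `|dotr a z|%:E)%E.
    have c0 : 0 <= t ^+ 3 / 16 by rewrite divr_ge0// exprn_ge0// ltW.
    apply: (@le_trans _ _ ((t ^+ 3 / 16)%:E *
        \int[gamma]_z (dotr a z ^+ 4)%:E + \int[gamma]_z `|dotr a z|%:E)%E).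
      rewrite -[X in (X + _)%E]add0e -ge0_integral_probability_affine//.
      rewrite -gm2 -ge0_integralZl//=.
      - apply: ge0_le_integral => //=.
        + move=> z _; rewrite -EFinM lee_fin mulr_ge0 ?sqr_ge0//.
          by rewrite mulr_ge0// ltW.
        + by apply/measurable_EFinP; apply: measurable_funM.
        + apply/measurable_EFinP; apply: measurable_funD => //.
          by apply: measurable_funD => //; apply: measurable_funM.
        + by move=> z _; rewrite -EFinM lee_fin.
      - exact/measurable_EFinP.
      - by move=> z _; rewrite lee_fin sqr_ge0.
      - by rewrite lee_fin mulr_ge0// ltW.
    by rewrite leeD2r// lee_wpmul2l// ?lee_fin.
  have : (0 <= \int[gamma]_z `|dotr a z|%:E)%E.
    by apply: integral_ge0 => z _; rewrite lee_fin.
  case: (\int[gamma]_z _)%E => [x|_ _|]; [|exact: leey|by rewrite leeNy_eq].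
  rewrite -!EFinM -EFinD !lee_fin => _.
  have -> : 3 / 4 * t * (v2 * S) = 3 / 4 * l * v2 * s.
    by rewrite -sS /t; field.
  have -> : t ^+ 3 / 16 * (K * S ^+ 2) = l ^+ 3 * K / 16 * s.
    by rewrite -sS /t; field.
  by rewrite /alpha mulrBl lerBlDl.
(* The inequality of arithmetic and geometric means, with equality at [|x| = s]. The final zero fits
   the shape of [ge0_integral_probability_affine]. *)
have up z : `|dotr a z| <= s / 2 + (2 * s)^-1 * dotr a z ^+ 2 + 0.
  have -> : dotr a z ^+ 2 = `|dotr a z| ^+ 2 by rewrite real_normK ?num_real.
  move: (`|dotr a z|) => y; rewrite -subr_ge0.
  have -> : s / 2 + (2 * s)^-1 * y ^+ 2 + 0 - y = (y - s) ^+ 2 / (2 * s).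
    by field.
  by rewrite divr_ge0 ?sqr_ge0 ?mulr_ge0 ?(ltW s0).
apply: (@le_trans _ _ (\int[gamma]_z
    (s / 2 + (2 * s)^-1 * dotr a z ^+ 2 + cst 0 z)%:E)%E).
  apply: ge0_le_integral => //=.
  - exact/measurable_EFinP.
  - apply/measurable_EFinP; apply: measurable_funD => //.
    by apply: measurable_funD => //; apply: measurable_funM.
  - by move=> z _; rewrite lee_fin; exact: up.
rewrite ge0_integral_probability_affine//.
- rewrite gm2 [X in (_ + X)%E]integral0_eq// adde0 -EFinM -EFinD lee_fin.
  rewrite le_eqVlt; apply/orP; left; apply/eqP.
  by rewrite -/v2 -/S -sS; field.
- by rewrite divr_ge0// ltW.
- by rewrite invr_ge0 mulr_ge0// ltW.
- by move=> z; exact: sqr_ge0.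
Qed.

(** * Gaussian vectors as linear images *)

Lemma measurable_bigmaxr d (T : measurableType d) (R : realType) (I : Type)
    (r : seq I) (D : set T) (f : I -> T -> R) :
  (forall i, measurable_fun D (f i)) ->
  measurable_fun D (fun x => \big[Num.max/0]_(i <- r) f i x).
Proof.
move=> mf; elim: r => [|i r IHr].
  by under eq_fun do rewrite big_nil; exact: measurable_cst.
by under eq_fun do rewrite big_cons; exact: measurable_maxr.
Qed.

Lemma unvecK (R : realType) (n : nat) : cancel (@unvec R n) (@vec R n).
Proof.
move=> x; apply/matrixP => i j.
by rewrite ord1 /vec /unvec mxE tnth_mktuple.
Qed.

Lemma mulmx_vec (R : realType) (m n : nat) (A : 'M[R]_(m, n)) (z : n.-tuple R) i :
  (A *m vec z) i 0 = dotr (A i) z.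
Proof. by rewrite mxE; apply: eq_bigr => j _; rewrite mxE. Qed.

Definition tuple_mulmx (R : realType) (n : nat) (B : 'M[R]_n) (z : n.-tuple R) :
  n.-tuple R := unvec (B *m vec z).

Lemma measurable_tuple_mulmx (R : realType) (n : nat) (B : 'M[R]_n) :
  measurable_fun [set: n.-tuple R] (tuple_mulmx B).
Proof.
apply/measurable_fun_tnthP => i.
rewrite (_ : _ \o _ = dotr (B i)); first exact: measurable_dotr.
by apply/funext => z; rewrite /= tnth_mktuple mulmx_vec.
Qed.

HB.instance Definition _ (R : realType) (n : nat) (B : 'M[R]_n) :=
  isMeasurableFun.Build _ _ _ _ (tuple_mulmx B) (measurable_tuple_mulmx B).

Lemma mulmx_tuple_mulmx (R : realType) (m n : nat) (A : 'M[R]_(m, n))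
    (B : 'M[R]_n) (z : n.-tuple R) i :
  (A *m vec (tuple_mulmx B z)) i 0 = dotr ((A *m B) i) z.
Proof. by rewrite /tuple_mulmx unvecK mulmxA mulmx_vec. Qed.

Lemma gaussian_vector_tuple_mulmx (R : realType) (n : nat) (B : 'M[R]_n)
    (gamma : probability (n.-tuple R) R) : std_gaussian gamma ->
  @gaussian_vector R n (B *m B^T) _ _ gamma (tuple_mulmx B).
Proof. by move=> gG; exists B, gamma. Qed.

(** Expectations depend on the law of [g] only, so the arbitrary probability space is replaced by
    one fixed [gamma]. The matrix [B] is chosen before [f], hence serves all test functions at
    once. *)
Lemma gaussian_vector_expectation (R : realType) (n : nat) (Sigma : 'M[R]_n)
    (d : measure_display) (T : measurableType d) (P : probability T R)
    (g : {RV P >-> n.-tuple R}) (gamma : probability (n.-tuple R) R) :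
  gaussian_vector Sigma g -> std_gaussian gamma ->
  exists2 B : 'M[R]_n, B *m B^T = Sigma & forall f : n.-tuple R -> R,
    measurable_fun [set: n.-tuple R] f -> (forall z, 0 <= f z) ->
    ('E_P[fun w => f (g w)] = \int[gamma]_z (f (tuple_mulmx B z))%:E)%E.
Proof.
move=> [B [gamma' [BB g'G dg]]] gG; exists B => // f mf f0.
have mEf : measurable_fun [set: n.-tuple R] (EFin \o f) by exact/measurable_EFinP.
have f0' z : (0 <= (EFin \o f) z)%E by rewrite lee_fin.
rewrite unlock.
transitivity (\int[distribution P g]_z (EFin \o f) z)%E.
  by rewrite ge0_integral_distribution.
transitivity (\int[distribution gamma' (tuple_mulmx B)]_z (EFin \o f) z)%E.
  by apply: eq_measure_integral => S mS _; exact: dg.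
rewrite ge0_integral_distribution//.
exact: std_gaussian_eq_integral.
Qed.

Lemma psd_mulmx_tr (R : realType) (n : nat) (B : 'M[R]_n) : psd (B *m B^T).
Proof.
split; first by rewrite trmx_mul trmxK.
move=> v; rewrite mulmxA -mulmxA -{1}[B]trmxK -trmx_mul mxE sumr_ge0// => i _.
by rewrite mxE -expr2 sqr_ge0.
Qed.

Lemma mulmx_tr_diag (R : realType) (p q : nat) (B : 'M[R]_(p, q)) j :
  (B *m B^T) j j = \sum_(k < q) B j k ^+ 2.
Proof. by rewrite mxE; apply: eq_bigr => k _; rewrite mxE expr2. Qed.

(** The competitors become matrices with unit rows, since the diagonal of [B B^T] consists of the
    squared row norms. Conversely, each such [B] is realized on the space of [gamma] itself by
    [tuple_mulmx B]. *)
Lemma V_valuesP (R : realType) (m n : nat) (A : 'M[R]_(m, n))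
    (gamma : probability (n.-tuple R) R) (x : \bar R) :
  std_gaussian gamma ->
  V_values A x <-> exists B : 'M[R]_n, (forall j, \sum_(k < n) B j k ^+ 2 = 1) /\
    x = (\big[maxe/0]_(i < m) \int[gamma]_z `|dotr ((A *m B) i) z|%:E)%E.
Proof.
move=> gG.
have mA i : measurable_fun [set: n.-tuple R] (fun z => `|(A *m vec z) i 0|).
  apply: measurableT_comp => //.
  under eq_fun do rewrite mulmx_vec.
  exact: measurable_dotr.
split.
  move=> [Sigma [d [T [P [g [_ S1 gS ->]]]]]].
  have [B BB Ef] := gaussian_vector_expectation gS gG.
  exists B; split; first by move=> j; rewrite -mulmx_tr_diag BB.
  apply: eq_bigr => i _; rewrite (Ef _ (mA i))//.
  by apply: eq_integral => z _; rewrite mulmx_tuple_mulmx.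
move=> [B [B1 ->]].
exists (B *m B^T), _, _, gamma, (tuple_mulmx B); split.
- exact: psd_mulmx_tr.
- by move=> j; rewrite mulmx_tr_diag.
- exact: gaussian_vector_tuple_mulmx.
- apply: eq_bigr => i _; rewrite unlock.
  by apply: eq_integral => z _; rewrite mulmx_tuple_mulmx.
Qed.

Lemma S_valuesP (R : realType) (m n : nat) (A : 'M[R]_(m, n))
    (gamma : probability (n.-tuple R) R) (x : \bar R) :
  std_gaussian gamma ->
  S_values A x <-> exists B : 'M[R]_n,
    \sum_(j < n) \sum_(k < n) B j k ^+ 2 = n%:R /\
    x = (\int[gamma]_z (\big[Num.max/0]_(i < m) `|dotr ((A *m B) i) z|)%:E)%E.
Proof.
move=> gG.
have mA : measurable_fun [set: n.-tuple R]
    (fun z => \big[Num.max/0]_(i < m) `|(A *m vec z) i 0|).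
  apply: measurable_bigmaxr => i; apply: measurableT_comp => //.
  under eq_fun do rewrite mulmx_vec.
  exact: measurable_dotr.
have A0 z : 0 <= \big[Num.max/0]_(i < m) `|(A *m vec z) i 0| by exact: bigmax_ge_id.
have trB (B : 'M[R]_n) : \tr (B *m B^T) = \sum_(j < n) \sum_(k < n) B j k ^+ 2.
  by apply: eq_bigr => j _; rewrite mulmx_tr_diag.
split.
  move=> [Sigma [d [T [P [g [_ S1 gS ->]]]]]].
  have [B BB Ef] := gaussian_vector_expectation gS gG.
  exists B; split; first by rewrite -trB BB.
  rewrite (Ef _ mA)//; apply: eq_integral => z _; congr EFin.
  by apply: eq_bigr => i _; rewrite mulmx_tuple_mulmx.
move=> [B [B1 ->]].
exists (B *m B^T), _, _, gamma, (tuple_mulmx B); split.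
- exact: psd_mulmx_tr.
- by rewrite trB.
- exact: gaussian_vector_tuple_mulmx.
- rewrite expectation.unlock; apply: eq_integral => z _; congr EFin.
  by apply: eq_bigr => i _; rewrite mulmx_tuple_mulmx.
Qed.

(** * Compactness and continuity on matrices *)

(** Compactness of closed bounded sets of row vectors is transported along [vec_mx], which is
    continuous because it only rearranges the entries. *)
Lemma closed_bounded_mx_compact (R : realType) (p q : nat) (K : set 'M[R]_(p, q))
    (M : R) :
  closed K -> (forall B, K B -> forall i j, `|B i j| <= M) -> compact K.
Proof.
move=> cK bK.
have vec_cont : continuous (vec_mx : 'rV[R]_(p * q) -> 'M[R]_(p, q)).
  move=> v W /nbhs_ballP[e /= e0 eW]; apply/nbhs_ballP; exists e => //= w [_ vw].
  by apply: eW; split=> // i j; rewrite !mxE; exact: vw.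
rewrite (_ : K = vec_mx @` (vec_mx @^-1` K)); last first.
  apply/seteqP; split=> [B KB|_ [v Kv <-]]//.
  by exists (mxvec B); rewrite /= ?mxvecK.
apply: continuous_compact; first exact: continuous_subspaceT.
apply: bounded_closed_compact; last exact: closed_comp.
exists `|M|; split => [|r Mr v /= Kv]; first exact: num_real.
rewrite [leLHS]mx_normrE; apply: bigmax_le => [|[i k] _ /=].
  exact: le_trans (ltW Mr).
rewrite (ord1 i); case/mxvec_indexP: k => a b.
have -> : v 0 (mxvec_index a b) = vec_mx v a b by rewrite mxE.
by rewrite (le_trans (bK _ Kv a b))// (le_trans (ler_norm _))// ltW.
Qed.

Lemma compact_min_mx (R : realType) (p q : nat) (K : set 'M[R]_(p, q)) (f : 'M[R]_(p, q) -> R) :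
  K !=set0 -> compact K -> continuous f ->
  exists2 B, K B & forall C, K C -> f B <= f C.
Proof.
move=> K0 cK cf.
have [|B] := @compact_EVT_min _ _ f _ K0 cK; first exact: continuous_subspaceT.
by rewrite inE => KB fB; exists B => // C KC; apply: fB; rewrite inE.
Qed.

Lemma cvg_sumr (R : realType) (T I : Type) (F : set_system T) (r : seq I)
    (P : pred I) (f : I -> T -> R) (a : I -> R) {FF : Filter F} :
  (forall i, P i -> f i x @[x --> F] --> a i) ->
  \sum_(i <- r | P i) f i x @[x --> F] --> \sum_(i <- r | P i) a i.
Proof. by move=> fa; apply: cvg_big => //; exact: add_continuous. Qed.

Lemma continuous_mx_entry_sqr (R : realType) (p q : nat) (i : 'I_p) (j : 'I_q) :
  continuous (fun B : 'M[R]_(p, q) => B i j ^+ 2).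
Proof.
move=> B; apply: (cvg_comp (fun B : 'M[R]_(p, q) => B i j) (fun x => x ^+ 2)).
  exact: coord_continuous.
exact: sqr_continuous.
Qed.

Lemma closed_row_sum_sqr (R : realType) (p q : nat) (i : 'I_p) (c : R) :
  closed [set B : 'M[R]_(p, q) | \sum_(k < q) B i k ^+ 2 = c].
Proof.
apply: (@closed_comp _ _ (fun B : 'M[R]_(p, q) => \sum_(k < q) B i k ^+ 2)
  [set c]); last exact: closed_eq.
move=> B _; apply: (@cvg_sumr _ _ _ (nbhs B)) => k _.
exact: continuous_mx_entry_sqr.
Qed.

Lemma closed_sum_sqr (R : realType) (p q : nat) (c : R) :
  closed [set B : 'M[R]_(p, q) | \sum_(j < p) \sum_(k < q) B j k ^+ 2 = c].
Proof.
apply: (@closed_comp _ _ (fun B : 'M[R]_(p, q) =>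
  \sum_(j < p) \sum_(k < q) B j k ^+ 2) [set c]); last exact: closed_eq.
move=> B _; apply: (@cvg_sumr _ _ _ (nbhs B) _ _
  (fun j (B : 'M[R]_(p, q)) => \sum_(k < q) B j k ^+ 2)) => j _.
apply: (@cvg_sumr _ _ _ (nbhs B)) => k _.
exact: continuous_mx_entry_sqr.
Qed.

Lemma compact_row_spheres (R : realType) (p q : nat) :
  compact [set B : 'M[R]_(p, q) | forall j, \sum_(k < q) B j k ^+ 2 = 1].
Proof.
apply: (@closed_bounded_mx_compact _ _ _ _ 1) => [|B B1 i j].
  rewrite (_ : mkset _ = \bigcap_(j in [set: 'I_p])
      [set B : 'M[R]_(p, q) | \sum_(k < q) B j k ^+ 2 = 1]); last first.
    by apply/seteqP; split=> B B1 j; [move=> _; exact: B1|exact: (B1 j I)].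
  by apply: closed_bigI => j _; exact: closed_row_sum_sqr.
have : B i j ^+ 2 <= 1.
  by rewrite -(B1 i) (bigD1 j)//= lerDl sumr_ge0// => k _; exact: sqr_ge0.
by rewrite -[B i j ^+ 2]real_normK ?num_real// expr_le1.
Qed.

Lemma compact_sphere (R : realType) (p q : nat) (c : R) :
  compact [set B : 'M[R]_(p, q) | \sum_(j < p) \sum_(k < q) B j k ^+ 2 = c].
Proof.
(* From [b^2 <= c] follows [b <= 1 + c], which avoids a square root. *)
apply: (@closed_bounded_mx_compact _ _ _ _ (1 + c)) => [|B /= Bc i j].
  exact: closed_sum_sqr.
have : B i j ^+ 2 <= c.
  rewrite -Bc (bigD1 i)//= (bigD1 j)//= -addrA lerDl addr_ge0// sumr_ge0// => k _.
    exact: sqr_ge0.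
  by apply: sumr_ge0 => l _; exact: sqr_ge0.
rewrite -[B i j ^+ 2]real_normK ?num_real//.
by move: (`|B i j|) => b; nra.
Qed.

Lemma le_bigmax_add (R : realType) (m : nat) (x y d : 'I_m -> R) :
  (forall i, 0 <= d i) -> (forall i, x i <= y i + d i) ->
  \big[Num.max/0]_(i < m) x i <= \big[Num.max/0]_(i < m) y i + \sum_(i < m) d i.
Proof.
move=> d0 xy; apply: bigmax_le => [|i _].
  by rewrite addr_ge0 ?bigmax_ge_id ?sumr_ge0.
apply: (le_trans (xy i)); apply: lerD; first exact: le_bigmax_cond.
by rewrite (bigD1 i)//= lerDl sumr_ge0.
Qed.

(** A common criterion for the four objective functions. The one-sided hypothesis, used in both
    directions, bounds the variation of [phi] by a multiple of the entrywise distance of the two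
    products, which tends to zero. *)
Lemma continuous_mulmx_subadditive (R : realType) (m p q : nat)
    (A : 'M[R]_(m, p)) (L : R) (phi : 'M[R]_(m, q) -> R) :
  (forall M N, phi M <= phi N + L * \sum_(i < m) \sum_(k < q) `|M i k - N i k|) ->
  continuous (fun B : 'M[R]_(p, q) => phi (A *m B)).
Proof.
move=> phiL B.
pose g (C : 'M[R]_(p, q)) :=
  L * \sum_(i < m) \sum_(k < q) `|\sum_(j < p) A i j * (B j k - C j k)|.
have gE C : g C = L * \sum_(i < m) \sum_(k < q) `|(A *m B) i k - (A *m C) i k|.
  congr (_ * _); apply: eq_bigr => i _; apply: eq_bigr => k _.
  by rewrite !mxE -sumrB; under eq_bigr do rewrite mulrBr.
have g_cvg : g C @[C --> B] --> g B.
  apply: (@cvgM _ _ (nbhs B) _ (cst L)); first exact: (@cvg_cst _ _ _ (nbhs B)).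
  apply: (@cvg_sumr _ _ _ (nbhs B) _ _
    (fun i C => \sum_(k < q) `|\sum_(j < p) A i j * (B j k - C j k)|)) => i _.
  apply: (@cvg_sumr _ _ _ (nbhs B) _ _
    (fun k C => `|\sum_(j < p) A i j * (B j k - C j k)|)) => k _.
  apply: cvg_norm; apply: (@cvg_sumr _ _ _ (nbhs B) _ _
    (fun j C => A i j * (B j k - C j k))) => j _.
  apply: (@cvgM _ _ (nbhs B) _ (cst (A i j))); first exact: (@cvg_cst _ _ _ (nbhs B)).
  apply: (@cvgB _ _ _ (nbhs B) _ (cst (B j k))); first exact: (@cvg_cst _ _ _ (nbhs B)).
  exact: coord_continuous.
have g0 : g B = 0.
  rewrite gE big1 ?mulr0// => i _; rewrite big1// => k _.
  by rewrite subrr normr0.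
apply/(@cvgrPdist_lt _ _ _ (nbhs B)) => e e0.
move: g_cvg => /(@cvgrPdist_lt _ _ _ (nbhs B))/(_ e e0); apply: filterS => C.
rewrite g0 sub0r normrN => ge; apply: le_lt_trans ge.
apply: le_trans (ler_norm _).
have := phiL (A *m B) (A *m C); have := phiL (A *m C) (A *m B).
under eq_bigr do under eq_bigr do rewrite distrC.
rewrite -gE ler_norml; move: (phi _) (phi _) (g C) => u v w uv vu.
by apply/andP; split; lra.
Qed.

Lemma sqrt_sum_sqr_le_sum_norm (R : realType) (q : nat) (x : 'I_q -> R) :
  Num.sqrt (\sum_k x k ^+ 2) <= \sum_k `|x k|.
Proof.
have s0 : 0 <= \sum_k `|x k| by exact: sumr_ge0.
rewrite -[leRHS]ger0_norm// -sqrtr_sqr ler_wsqrtr// expr2 mulr_suml.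
apply: ler_sum => k _; rewrite -real_normK ?num_real// expr2 ler_wpM2l//.
by rewrite (bigD1 k)//= lerDl sumr_ge0.
Qed.

(** With [Y] and [D] the two terms on the right, [x_k^2 <= y_k^2 + (2Y + D) |x_k - y_k|] for each
    [k], and the right-hand sides add up to [(Y + D)^2]. *)
Lemma sqrt_sum_sqr_le_add (R : realType) (q : nat) (x y : 'I_q -> R) :
  Num.sqrt (\sum_k x k ^+ 2) <=
  Num.sqrt (\sum_k y k ^+ 2) + \sum_k `|x k - y k|.
Proof.
set Y := Num.sqrt (\sum_k y k ^+ 2); set D := \sum_k `|x k - y k|.
have Y0 : 0 <= Y by exact: sqrtr_ge0.
have D0 : 0 <= D by exact: sumr_ge0.
have YE : Y ^+ 2 = \sum_k y k ^+ 2.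
  by rewrite sqr_sqrtr// sumr_ge0// => k _; exact: sqr_ge0.
have yY k : `|y k| <= Y.
  rewrite -sqrtr_sqr ler_wsqrtr// (bigD1 k)//= lerDl sumr_ge0// => j _.
  exact: sqr_ge0.
have dD k : `|x k - y k| <= D by rewrite /D (bigD1 k)//= lerDl sumr_ge0.
rewrite -[leRHS]ger0_norm ?addr_ge0// -sqrtr_sqr ler_wsqrtr//.
apply: (@le_trans _ _ (\sum_k (y k ^+ 2 + (2 * Y + D) * `|x k - y k|))).
  apply: ler_sum => k _.
  have h1 : y k * (x k - y k) <= Y * `|x k - y k|.
    by rewrite (le_trans (ler_norm _))// normrM ler_wpM2r.
  have h2 : (x k - y k) ^+ 2 <= D * `|x k - y k|.
    by rewrite -real_normK ?num_real// expr2 ler_wpM2r.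
  by move: (`|_|) h1 h2 => d; lra.
rewrite big_split/= -mulr_sumr -YE -/D.
by have -> : (Y + D) ^+ 2 = Y ^+ 2 + (2 * Y + D) * D by ring.
Qed.

Lemma continuous_bigmax_row_norm (R : realType) (m p q : nat) (A : 'M[R]_(m, p)) :
  continuous (fun B : 'M[R]_(p, q) =>
    \big[Num.max/0]_(i < m) Num.sqrt (\sum_(k < q) (A *m B) i k ^+ 2)).
Proof.
apply: (@continuous_mulmx_subadditive _ _ _ _ _ 1 (fun M : 'M[R]_(m, q) =>
    \big[Num.max/0]_(i < m) Num.sqrt (\sum_(k < q) M i k ^+ 2))) => M N.
rewrite mul1r; apply: le_bigmax_add => i; first exact: sumr_ge0.
exact: sqrt_sum_sqr_le_add.
Qed.

Lemma mx_norm_colE (R : realType) (m : nat) (y : 'cV[R]_m) :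
  `|y| = \big[Num.max/0]_(i < m) `|y i 0|.
Proof.
rewrite [LHS]mx_normrE; apply/eqP; rewrite eq_le; apply/andP; split.
  apply: bigmax_le => [|[i j] _]; first exact: bigmax_ge_id.
  by rewrite ord1; exact: (le_bigmax_cond 0 (fun i => `|y i 0|)).
apply: bigmax_le => [|i _]; first exact: bigmax_ge_id.
exact: (le_bigmax_cond 0 (fun ij : 'I_m * 'I_1 => `|y ij.1 ij.2|) (j := (i, 0))).
Qed.

Lemma continuous_norm_mulmx (R : realType) (m p : nat) (A : 'M[R]_(m, p)) :
  continuous (fun x : 'cV[R]_p => `|A *m x| : R).
Proof.
apply: (@continuous_mulmx_subadditive _ _ _ _ _ 1
  (fun y : 'cV[R]_m => `|y| : R)) => M N.
rewrite mul1r !mx_norm_colE; apply: le_bigmax_add => i; first exact: sumr_ge0.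
rewrite big_ord1 addrC -lerBlDr; exact: lerB_dist.
Qed.

(** * Expectations as functions of the matrix *)

Lemma ge0_integral_sumZ d (T : measurableType d) (R : realType)
    (P : probability T R) (m : nat) (c : 'I_m -> R) (f : 'I_m -> T -> R) :
  (forall i, 0 <= c i) -> (forall i, measurable_fun [set: T] (f i)) ->
  (forall i x, 0 <= f i x) ->
  (\int[P]_x (\sum_(i < m) c i * f i x)%:E =
   \sum_(i < m) (c i)%:E * \int[P]_x (f i x)%:E)%E.
Proof.
move=> c0 mf f0.
under eq_integral do rewrite -sumEFin.
rewrite ge0_integral_sum//.
- apply: eq_bigr => i _.
  under eq_integral do rewrite EFinM.
  rewrite ge0_integralZl//; first exact/measurable_EFinP.
    by move=> x _; rewrite lee_fin.
  by rewrite lee_fin.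
- by move=> i; apply/measurable_EFinP; exact: measurable_funM.
- by move=> i x _; rewrite lee_fin mulr_ge0.
Qed.

Lemma dotr_subK (R : realType) (n : nat) (a b : 'I_n -> R) (z : n.-tuple R) :
  dotr b z + dotr (fun k => a k - b k) z = dotr a z.
Proof.
by rewrite /dotr -big_split/=; apply: eq_bigr => k _; rewrite mulrBl subrKC.
Qed.

Section gaussian_functionals.
Variables (R : realType) (n : nat) (gamma : probability (n.-tuple R) R) (beta : R).
Hypothesis beta_ge0 : 0 <= beta.
Hypothesis moment_le : forall a : 'I_n -> R,
  (\int[gamma]_z `|dotr a z|%:E <= (beta * Num.sqrt (\sum_(i < n) a i ^+ 2))%:E)%E.

Let measurable_abs_dotr (a : 'I_n -> R) :
  measurable_fun [set: n.-tuple R] (fun z => `|dotr a z|).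
Proof. by apply: measurableT_comp => //; exact: measurable_dotr. Qed.

Let moment_le_sum (a : 'I_n -> R) :
  (\int[gamma]_z `|dotr a z|%:E <= (beta * \sum_(i < n) `|a i|)%:E)%E.
Proof.
by rewrite (le_trans (moment_le a))// lee_fin ler_wpM2l// sqrt_sum_sqr_le_sum_norm.
Qed.

(** [max_moment] and [moment_max] are the real-valued objectives of V(A) and S(A) at [M = A B].
    Under the moment bound the integrals are finite, so [fine] loses nothing. *)
Definition max_moment (m : nat) (M : 'M[R]_(m, n)) : R :=
  \big[Num.max/0]_(i < m) fine (\int[gamma]_z `|dotr (M i) z|%:E).

Definition moment_max (m : nat) (M : 'M[R]_(m, n)) : R :=
  fine (\int[gamma]_z (\big[Num.max/0]_(i < m) `|dotr (M i) z|)%:E).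

Lemma momentE (a : 'I_n -> R) :
  (\int[gamma]_z `|dotr a z|%:E = (fine (\int[gamma]_z `|dotr a z|%:E))%:E)%E.
Proof.
rewrite fineK// ge0_fin_numE; last by apply: integral_ge0 => z _; rewrite lee_fin.
exact: le_lt_trans (moment_le a) (ltry _).
Qed.

Lemma max_momentE (m : nat) (M : 'M[R]_(m, n)) :
  (\big[maxe/0]_(i < m) \int[gamma]_z `|dotr (M i) z|%:E = (max_moment M)%:E)%E.
Proof.
by under eq_bigr do rewrite momentE; rewrite EFin_bigmax.
Qed.

(** Pointwise, the maximum for [M] exceeds that for [N] by at most the sum over the rows of the
    forms of [M - N]. Taking [N = 0] gives finiteness; general [N] gives continuity. *)
Let integral_max_le (m : nat) (M N : 'M[R]_(m, n)) :
  (\int[gamma]_z (\big[Num.max/0]_(i < m) `|dotr (M i) z|)%:E <=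
   \int[gamma]_z (\big[Num.max/0]_(i < m) `|dotr (N i) z|)%:E +
   (beta * \sum_(i < m) \sum_(k < n) `|M i k - N i k|)%:E)%E.
Proof.
pose D i := fun k => M i k - N i k.
have mmax (M' : 'M[R]_(m, n)) : measurable_fun [set: n.-tuple R]
    (fun z => \big[Num.max/0]_(i < m) `|dotr (M' i) z|).
  exact: measurable_bigmaxr.
have mD : measurable_fun [set: n.-tuple R]
    (fun z => \sum_(i < m) 1 * `|dotr (D i) z|).
  by apply: measurable_sum => i; exact: measurable_funM.
have D0 z : 0 <= \sum_(i < m) 1 * `|dotr (D i) z|.
  by apply: sumr_ge0 => i _; rewrite mul1r.
apply: (@le_trans _ _ (\int[gamma]_z
    (0 + 1 * \big[Num.max/0]_(i < m) `|dotr (N i) z| +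
     \sum_(i < m) 1 * `|dotr (D i) z|)%:E)%E).
  apply: ge0_le_integral => //=.
  - by move=> z _; rewrite lee_fin bigmax_ge_id.
  - exact/measurable_EFinP.
  - apply/measurable_EFinP; apply: measurable_funD => //.
    by apply: measurable_funD => //; exact: measurable_funM.
  - move=> z _; rewrite lee_fin add0r mul1r.
    under [X in _ + X]eq_bigr do rewrite mul1r.
    by apply: le_bigmax_add => // i; rewrite -(dotr_subK (M i) (N i)) ler_normD.
rewrite ge0_integral_probability_affine//; last first.
  by move=> z; exact: bigmax_ge_id.
rewrite add0e mul1e leeD2l// ge0_integral_sumZ//.
rewrite mulr_sumr -sumEFin; apply: lee_sum => i _.
by rewrite mul1e; exact: moment_le_sum.
Qed.

Lemma moment_maxE (m : nat) (M : 'M[R]_(m, n)) :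
  (\int[gamma]_z (\big[Num.max/0]_(i < m) `|dotr (M i) z|)%:E = (moment_max M)%:E)%E.
Proof.
rewrite fineK// ge0_fin_numE; last first.
  by apply: integral_ge0 => z _; rewrite lee_fin bigmax_ge_id.
apply: (le_lt_trans (integral_max_le M 0)).
rewrite [X in (X + _)%E]integral0_eq ?add0e ?ltry// => z _; congr EFin.
apply/le_anti; rewrite bigmax_ge_id andbT; apply: bigmax_le => // i _.
by rewrite /dotr big1 ?normr0// => k _; rewrite mxE mul0r.
Qed.

Lemma continuous_max_moment (m p : nat) (A : 'M[R]_(m, p)) :
  continuous (fun B => max_moment (A *m B)).
Proof.
apply: (@continuous_mulmx_subadditive _ _ _ _ _ beta (@max_moment m)) => M N.
rewrite mulr_sumr; apply: le_bigmax_add => i; first by rewrite mulr_ge0// sumr_ge0.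
rewrite -lee_fin EFinD -!momentE.
apply: (@le_trans _ _ (\int[gamma]_z
    (0 + 1 * `|dotr (N i) z| + `|dotr (fun k => M i k - N i k) z|)%:E)%E).
  apply: ge0_le_integral => //=.
  - exact/measurable_EFinP.
  - apply/measurable_EFinP; apply: measurable_funD => //.
    by apply: measurable_funD => //; exact: measurable_funM.
  - move=> z _; rewrite lee_fin add0r mul1r.
    by rewrite -(dotr_subK (M i) (N i)) ler_normD.
rewrite ge0_integral_probability_affine//.
by rewrite add0e mul1e leeD2l.
Qed.

Lemma continuous_moment_max (m p : nat) (A : 'M[R]_(m, p)) :
  continuous (fun B => moment_max (A *m B)).
Proof.
apply: (@continuous_mulmx_subadditive _ _ _ _ _ beta (@moment_max m)) => M N.
by rewrite -lee_fin EFinD -!moment_maxE.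
Qed.

End gaussian_functionals.

(** * Attained infima, and the discrepancies as minima over matrices *)

Lemma inf_min (R : realType) (T : Type) (K : set T) (f : T -> R) (S : set R) (x0 : T) :
  K x0 -> (forall x, K x -> f x0 <= f x) ->
  (forall y, S y <-> exists x, K x /\ y = f x) -> S (inf S) /\ inf S = f x0.
Proof.
move=> Kx0 fx0 SE.
have Sf : S (f x0) by apply/SE; exists x0.
have lb : lbound S (f x0) by move=> y /SE[x [Kx ->]]; exact: fx0.
have infE : inf S = f x0.
  apply/eqP; rewrite eq_le ge_inf//=; last by exists (f x0).
  by apply: lb_le_inf => //; exists (f x0).
by rewrite infE.
Qed.

Lemma ereal_inf_min (R : realType) (T : Type) (K : set T) (f : T -> R)
    (S : set (\bar R)) (x0 : T) :
  K x0 -> (forall x, K x -> f x0 <= f x) ->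
  (forall y, S y <-> exists x, K x /\ y = (f x)%:E) ->
  S (ereal_inf S) /\ ereal_inf S = (f x0)%:E.
Proof.
move=> Kx0 fx0 SE.
have Sf : S (f x0)%:E by apply/SE; exists x0.
have infE : ereal_inf S = (f x0)%:E.
  apply/eqP; rewrite eq_le ereal_inf_lbound//=.
  by apply: le_ereal_inf_tmp => y /SE[x [Kx ->]]; rewrite lee_fin fx0.
by rewrite infE.
Qed.

(** The vectors [u j] are the rows of [B], so the parameter set is the same as in [V_valuesP]. *)
Lemma vdisc_valuesP (R : realType) (m n : nat) (A : 'M[R]_(m, n)) (x : R) :
  vdisc_values A x <-> exists B : 'M[R]_n, (forall j, \sum_(k < n) B j k ^+ 2 = 1) /\
    x = \big[Num.max/0]_(i < m) Num.sqrt (\sum_(k < n) (A *m B) i k ^+ 2).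
Proof.
have normE (u : 'I_n -> 'cV[R]_n) (B : 'M[R]_n) : (forall j k, B j k = u j k 0) ->
    forall i, norm2 (\sum_(j < n) A i j *: u j) =
    Num.sqrt (\sum_(k < n) (A *m B) i k ^+ 2).
  move=> Bu i; congr Num.sqrt; apply: eq_bigr => k _; congr (_ ^+ 2).
  by rewrite summxE mxE; apply: eq_bigr => j _; rewrite mxE Bu.
split=> [[u [u1 ->]]|[B [B1 ->]]].
  exists (\matrix_(j, k) u j k 0); split=> [j|].
    under eq_bigr do rewrite mxE.
    rewrite -[LHS]sqr_sqrtr ?sumr_ge0// => [|k _]; last exact: sqr_ge0.
    by have := u1 j; rewrite /norm2 => ->; rewrite expr1n.
  by apply: eq_bigr => i _; apply: normE => j k; rewrite mxE.
exists (fun j => \col_k B j k); split=> [j|].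
  by rewrite /norm2; under eq_bigr do rewrite mxE; rewrite B1 sqrtr1.
by apply: eq_bigr => i _; apply/esym/normE => j k; rewrite mxE.
Qed.

(** The inner sum over a single column puts the constraint in the form treated by
    [compact_sphere]. *)
Lemma sdisc_valuesP (R : realType) (m n : nat) (A : 'M[R]_(m, n)) (y : R) :
  sdisc_values A y <-> exists x : 'cV[R]_n,
    \sum_(j < n) \sum_(k < 1) x j k ^+ 2 = n%:R /\ y = `|A *m x|.
Proof.
have normE (x : 'cV[R]_n) :
    \sum_(j < n) \sum_(k < 1) x j k ^+ 2 = \sum_(j < n) x j 0 ^+ 2.
  by apply: eq_bigr => j _; rewrite big_ord1.
split=> -[x [xn ->]]; exists x; split=> //.
  rewrite normE -[LHS]sqr_sqrtr ?sumr_ge0// => [|j _]; last exact: sqr_ge0.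
  by rewrite -/(norm2 x) xn sqr_sqrtr.
by rewrite /norm2 -normE xn.
Qed.

(** * Comparison with the spherical discrepancy *)

(** For [B = x e_1^T], row [i] of [A B] is [(A x)_i e_1], so the maximum is at most the sup norm of
    [A x] times [|z_1|]. *)
Lemma moment_max_rank_one_le (R : realType) (m n : nat) (A : 'M[R]_(m, n.+1))
    (gamma : probability (n.+1.-tuple R) R) (beta : R) :
  (forall a : 'I_n.+1 -> R, (\int[gamma]_z `|dotr a z|%:E <=
     (beta * Num.sqrt (\sum_(i < n.+1) a i ^+ 2))%:E)%E) ->
  forall x : 'cV[R]_n.+1, exists B : 'M[R]_n.+1,
    \sum_j \sum_k B j k ^+ 2 = \sum_j \sum_(k < 1) x j k ^+ 2 /\
    moment_max gamma (A *m B) <= beta * `|A *m x|.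
Proof.
move=> mb x; pose D : 'rV[R]_n.+1 := delta_mx 0 0.
have D1 : \sum_k D 0 k ^+ 2 = 1.
  rewrite (bigD1 0)//= big1 => [|k k0]; first by rewrite mxE !eqxx expr1n addr0.
  by rewrite mxE eqxx (negbTE k0) expr0n.
exists (x *m D); split.
  apply: eq_bigr => j _; rewrite big_ord1 -[RHS]mulr1 -D1 mulr_sumr.
  by apply: eq_bigr => k _; rewrite mxE big_ord1 exprMn.
have mD : measurable_fun [set: n.+1.-tuple R] (fun z => `|dotr (D 0) z|).
  by apply: measurableT_comp => //; exact: measurable_dotr.
have beta_ge0 : 0 <= beta.
  have := le_trans _ (mb (D 0)); rewrite D1 sqrtr1 mulr1 -lee_fin; apply.
  by apply: integral_ge0 => z _; rewrite lee_fin.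
rewrite -lee_fin -(moment_maxE beta_ge0 mb).
apply: (@le_trans _ _ (\int[gamma]_z (`|A *m x|%:E * `|dotr (D 0) z|%:E))%E).
  apply: ge0_le_integral => //=.
  - by move=> z _; rewrite lee_fin bigmax_ge_id.
  - apply/measurable_EFinP; apply: measurable_bigmaxr => i.
    by apply: measurableT_comp => //; exact: measurable_dotr.
  - by apply: emeasurable_funM => //; exact/measurable_EFinP.
  - move=> z _; rewrite lee_fin; apply: bigmax_le => [|i _].
      by rewrite mulr_ge0.
    have -> : dotr ((A *m (x *m D)) i) z = (A *m x) i 0 * dotr (D 0) z.
      rewrite mulmxA /dotr mulr_sumr; apply: eq_bigr => k _.
      by rewrite [in LHS]mxE big_ord1 mulrA.
    rewrite normrM ler_wpM2r// mx_norm_colE.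
    exact: (le_bigmax_cond 0 (fun i => `|(A *m x) i 0|)).
rewrite ge0_integralZl//=; last first.
- by apply/measurable_EFinP.
rewrite (le_trans (lee_wpmul2l _ (mb _)))// ?lee_fin//.
by rewrite D1 sqrtr1 mulr1 mulrC.
Qed.

Lemma weighted_sum_le_norm_mulmx (R : realType) (m n : nat) (A : 'M[R]_(m, n))
    (F : R) (s : 'I_n -> R) (y : 'cV[R]_n) :
  0 <= F ->
  (forall x : 'cV[R]_n, \sum_(j < n) \sum_(k < 1) x j k ^+ 2 = n%:R ->
    F <= `|A *m x|) ->
  \sum_j s j ^+ 2 = n%:R ->
  \sum_j F * (s j * `|y j 0|) <= n%:R * `|A *m y|.
Proof.
case: n => [|n] in A s y *; first by move=> *; rewrite big_ord0 mul0r.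
move=> F0 Fmin sn; set N : R := n.+1%:R in Fmin sn *.
pose r := Num.sqrt N; pose S := \sum_j y j 0 ^+ 2; pose rho := Num.sqrt S.
have N0 : 0 < N by rewrite ltr0n.
have r0 : 0 < r by rewrite sqrtr_gt0.
have rN : r ^+ 2 = N by rewrite sqr_sqrtr// ltW.
have S0 : 0 <= S by apply: sumr_ge0 => j _; exact: sqr_ge0.
have rhoS : rho ^+ 2 = S by rewrite sqr_sqrtr.
have [rho_eq0|rho_neq0] := eqVneq rho 0.
  rewrite big1 ?mulr_ge0 ?ler0n ?(ltW N0)// => j _.
  have : S = 0 by rewrite -rhoS rho_eq0 expr0n.
  move=> /eqP; rewrite psumr_eq0 => [/allP/(_ j)|k _]; last exact: sqr_ge0.
  by rewrite mem_index_enum sqrf_eq0 => /(_ isT)/eqP ->; rewrite normr0 !mulr0.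
have rho0 : 0 < rho by rewrite lt_neqAle eq_sym rho_neq0 sqrtr_ge0.
(* Homogeneity: the hypothesis is applied to [y] rescaled to norm [r], the square root of the
   dimension. *)
have Fy : F * rho <= r * `|A *m y|.
  have := Fmin ((r / rho) *: y); rewrite -scalemxAr normrZ ger0_norm; last first.
    by rewrite divr_ge0 ?ltW.
  rewrite mulrAC ler_pdivlMr//; apply.
  under eq_bigr do rewrite big_ord1 mxE exprMn.
  by rewrite -mulr_sumr -/S -rhoS expr_div_n rN divfK// expf_neq0.
(* Cauchy-Schwarz through a weighted arithmetic-geometric inequality in each coordinate; the weights
   make both halves sum to [r rho / 2]. *)
have sy : \sum_j s j * `|y j 0| <= r * rho.
  apply: (@le_trans _ _ (\sum_j (rho / (2 * r) * s j ^+ 2 +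
      r / (2 * rho) * y j 0 ^+ 2))).
    apply: ler_sum => j _; rewrite -[y j 0 ^+ 2]real_normK ?num_real//.
    move: (`|y j 0|) => b; rewrite -subr_ge0.
    have -> : rho / (2 * r) * s j ^+ 2 + r / (2 * rho) * b ^+ 2 - s j * b =
        (rho * s j - r * b) ^+ 2 / (2 * (r * rho)).
      by field; rewrite !gt_eqF.
    by rewrite divr_ge0 ?sqr_ge0// ltW// !mulr_gt0.
  rewrite big_split/= -!mulr_sumr sn -/S -rhoS -rN.
  rewrite le_eqVlt; apply/orP; left; apply/eqP.
  by field; rewrite !gt_eqF.
rewrite -mulr_sumr (le_trans (ler_wpM2l F0 sy))// -rN expr2 mulrCA -mulrA.
by rewrite ler_wpM2l// ltW.
Qed.

(** [weighted_sum_le_norm_mulmx] is integrated at [y = B z], the weights being the row norms [s_j]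
    of [B]. Each [E |(B z)_j|] is at least [alpha s_j], so the sum regains [sum_j s_j^2 = n.+1],
    which cancels. *)
Lemma le_moment_max (R : realType) (m n : nat) (A : 'M[R]_(m, n.+1))
    (gamma : probability (n.+1.-tuple R) R) (alpha beta F : R) (B : 'M[R]_n.+1) :
  0 <= beta ->
  (forall a : 'I_n.+1 -> R, (\int[gamma]_z `|dotr a z|%:E <=
     (beta * Num.sqrt (\sum_(i < n.+1) a i ^+ 2))%:E)%E) ->
  (forall a : 'I_n.+1 -> R, ((alpha * Num.sqrt (\sum_(i < n.+1) a i ^+ 2))%:E <=
     \int[gamma]_z `|dotr a z|%:E)%E) ->
  0 <= F ->
  (forall x : 'cV[R]_n.+1, \sum_j \sum_(k < 1) x j k ^+ 2 = n.+1%:R ->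
    F <= `|A *m x|) ->
  \sum_j \sum_k B j k ^+ 2 = n.+1%:R ->
  alpha * F <= moment_max gamma (A *m B).
Proof.
move=> beta_ge0 mb ma F0 Fmin Bn.
pose s j := Num.sqrt (\sum_k B j k ^+ 2).
have sE j : s j ^+ 2 = \sum_k B j k ^+ 2.
  by rewrite sqr_sqrtr// sumr_ge0// => k _; exact: sqr_ge0.
have sn : \sum_j s j ^+ 2 = n.+1%:R by rewrite -Bn; apply: eq_bigr.
have N0 : 0 < n.+1%:R :> R by rewrite ltr0n.
have mM : measurable_fun [set: n.+1.-tuple R]
    (fun z => \big[Num.max/0]_(i < m) `|dotr ((A *m B) i) z|).
  apply: measurable_bigmaxr => i; apply: measurableT_comp => //.
  exact: measurable_dotr.
have mD j : measurable_fun [set: n.+1.-tuple R] (fun z => `|dotr (B j) z|).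
  by apply: measurableT_comp => //; exact: measurable_dotr.
have Fs0 j : 0 <= F * s j by rewrite mulr_ge0 ?sqrtr_ge0.
have : (\int[gamma]_z (\sum_j F * s j * `|dotr (B j) z|)%:E <=
    n.+1%:R%:E * (moment_max gamma (A *m B))%:E)%E.
  rewrite -(moment_maxE beta_ge0 mb) -ge0_integralZl//=.
  - apply: ge0_le_integral => //=.
    + by move=> z _; rewrite lee_fin sumr_ge0// => j _; rewrite mulr_ge0.
    + by apply/measurable_EFinP; apply: measurable_sum => j; exact: measurable_funM.
    + by apply: emeasurable_funM => //; exact/measurable_EFinP.
    + move=> z _; rewrite -EFinM lee_fin.
      have := weighted_sum_le_norm_mulmx (B *m vec z) F0 Fmin sn.
      rewrite mulmxA mx_norm_colE.
      under [X in _ <= _ * X -> _]eq_bigr do rewrite mulmx_vec.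
      apply: le_trans; apply: ler_sum => j _.
      by rewrite mulmx_vec mulrA.
  - exact/measurable_EFinP.
  - by move=> z _; rewrite lee_fin bigmax_ge_id.
rewrite ge0_integral_sumZ// => le1.
rewrite -(ler_pM2l N0) -lee_fin [in leRHS]EFinM; apply: le_trans le1.
apply: (@le_trans _ _ (\sum_j (F * s j)%:E * (alpha * s j)%:E)%E).
  under eq_bigr do rewrite -EFinM.
  rewrite sumEFin lee_fin -sn mulr_suml le_eqVlt; apply/orP; left; apply/eqP.
  by apply: eq_bigr => j _; ring.
by apply: lee_sum => j _; apply: lee_wpmul2l; rewrite ?lee_fin//; exact: ma.
Qed.

(* The first four conjuncts state that the infima defining the four quantities
   are minima. *)
Theorem theorem4 (R : realType) :
  exists c C : R, [/\ 0 < c, c <= C &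
    forall (m n : nat) (A : 'M[R]_(m, n)), (0 < m)%N -> (0 < n)%N ->
      [/\ vdisc_values A (disc_v A), sdisc_values A (disc_s A),
          V_values A (gaussian_V A) & S_values A (gaussian_S A)] /\
      (c%:E * gaussian_V A <= (disc_v A)%:E <= C%:E * gaussian_V A)%E /\
      (c%:E * gaussian_S A <= (disc_s A)%:E <= C%:E * gaussian_S A)%E].
Proof.
have [alpha [beta [alpha0 beta0 mom]]] := dotr_first_moment R.
have [gamma1 gG1] := std_gaussian_exists R 1.
(* The Gaussian quantities lie between [alpha] and [beta] times the discrepancies. Comparing the two
   moment bounds in dimension one at the coefficient 1 gives [alpha <= beta]. *)
exists beta^-1, alpha^-1; split.
- by rewrite invr_gt0.
- have [lo up] := mom _ _ gG1 (fun=> 1).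
  have := le_trans lo up; rewrite lee_fin big_ord1 expr1n sqrtr1 !mulr1 => ab.
  by rewrite lef_pV2.
move=> m [//|n] A _ _.
have [gamma gG] := std_gaussian_exists R n.+1.
have mb a := (mom _ _ gG a).2.
have ma a := (mom _ _ gG a).1.
have beta_ge0 := ltW beta0.
pose KV := [set B : 'M[R]_n.+1 | forall j, \sum_k B j k ^+ 2 = 1].
pose KS := [set B : 'M[R]_n.+1 | \sum_j \sum_k B j k ^+ 2 = n.+1%:R].
pose Ks := [set x : 'cV[R]_n.+1 | \sum_j \sum_k x j k ^+ 2 = n.+1%:R].
pose Fv (B : 'M[R]_n.+1) : R :=
  \big[Num.max/0]_(i < m) Num.sqrt (\sum_k (A *m B) i k ^+ 2).
(* The identity matrix and the all-ones vector show that the compact constraint sets are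
   nonempty. *)
have KV1 : KV 1%:M.
  move=> j; rewrite (bigD1 j)//= big1 => [|k kj].
    by rewrite mxE eqxx expr1n addr0.
  by rewrite mxE eq_sym (negbTE kj) expr0n.
have KS1 : KS 1%:M.
  rewrite /KS/= (eq_bigr (fun=> 1)) => [|j _]; last exact: KV1.
  by rewrite sumr_const card_ord.
have Ks1 : Ks (const_mx 1).
  rewrite /Ks/= (eq_bigr (fun=> 1)) => [|j _].
    by rewrite sumr_const card_ord.
  by rewrite big_ord1 mxE expr1n.
have [B1 KB1 B1min] := compact_min_mx (ex_intro _ _ KV1)
  (@compact_row_spheres _ _ _) (@continuous_max_moment _ _ _ _ beta_ge0 mb _ _ A).
have [B2 KB2 B2min] := compact_min_mx (ex_intro _ _ KV1)
  (@compact_row_spheres _ _ _) (@continuous_bigmax_row_norm _ _ _ _ A).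
have [B3 KB3 B3min] := compact_min_mx (ex_intro _ _ KS1)
  (@compact_sphere _ _ _ _) (@continuous_moment_max _ _ _ _ beta_ge0 mb _ _ A).
have [x4 Kx4 x4min] := compact_min_mx (ex_intro _ _ Ks1)
  (@compact_sphere _ _ _ _) (@continuous_norm_mulmx _ _ _ A).
have [att_v disc_vE] := inf_min KB2 B2min (vdisc_valuesP A).
have [att_s disc_sE] := inf_min Kx4 x4min (sdisc_valuesP A).
have VE x : V_values A x <-> exists B, KV B /\ x = (max_moment gamma (A *m B))%:E.
  rewrite (V_valuesP _ _ gG).
  by split=> -[B [KB ->]]; exists B; split=> //; rewrite (max_momentE mb).
have SE x : S_values A x <-> exists B, KS B /\ x = (moment_max gamma (A *m B))%:E.
  rewrite (S_valuesP _ _ gG).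
  by split=> -[B [KB ->]]; exists B; split=> //; rewrite (moment_maxE beta_ge0 mb).
have [att_V gaussian_VE] := ereal_inf_min KB1 B1min VE.
have [att_S gaussian_SE] := ereal_inf_min KB3 B3min SE.
split; first by split.
rewrite /gaussian_V /gaussian_S /disc_v /disc_s.
rewrite disc_vE disc_sE gaussian_VE gaussian_SE -!EFinM !lee_fin.
rewrite ![beta^-1 * _]mulrC ![alpha^-1 * _]mulrC.
rewrite !ler_pdivrMr// !ler_pdivlMr//.
have max_le B : max_moment gamma (A *m B) <= Fv B * beta.
  apply: bigmax_le => [|i _]; first by rewrite mulr_ge0// bigmax_ge_id.
  rewrite -lee_fin -(momentE mb); apply: (le_trans (mb _)).
  rewrite lee_fin mulrC ler_wpM2r//.
  exact: (le_bigmax_cond 0 (fun i => Num.sqrt (\sum_k (A *m B) i k ^+ 2))).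
have le_max B : Fv B * alpha <= max_moment gamma (A *m B).
  rewrite -ler_pdivlMr//; apply: bigmax_le => [|i _].
    by rewrite divr_ge0 ?bigmax_ge_id ?ltW.
  rewrite ler_pdivlMr// mulrC.
  apply: (@le_trans _ _ (fine (\int[gamma]_z `|dotr ((A *m B) i) z|%:E))).
    by rewrite -lee_fin -(momentE mb).
  exact: (le_bigmax_cond 0 (fun i => fine (\int[gamma]_z `|dotr ((A *m B) i) z|%:E))).
(* Once denominators are cleared, the first three inequalities evaluate one objective at a
   competitor taken from the other problem: [B2], then [B1], then the rank-one matrix built from
   [x4]. The last one takes [F] to be the minimal sup norm, attained at [x4]. *)
split; apply/andP; split.
- exact: le_trans (B1min _ KB2) (max_le _).
- by apply: le_trans (le_max B1); rewrite ler_wpM2r ?(ltW alpha0)//; exact: B2min.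
- have [B [KB Bx]] := moment_max_rank_one_le A mb x4.
  rewrite mulrC; apply: le_trans Bx; apply: B3min.
  by rewrite /KS/= KB.
- by rewrite mulrC; apply: (le_moment_max beta_ge0 mb ma).
Qed.
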